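(* For every $d\ge3$ and every learning rate $\eta>0$ there exists a loss sequence $\ell_1,\dots,\ell_T$ with $\ell_t\in[0,1]^d$ for all $t\in\{1,\dots,T\}$ such that the Hedge algorithm with learning rate $\eta$ suffers alternating regret $\mathrm{Reg}_{\mathrm{Alt}}=\Omega(T^{1/3})$.
   Context: $\Omega(T^{1/3})$ means: there are absolute constants $c>0$ and $T_0$ such that for all $T\ge T_0$ (and all $d\ge3$, $\eta>0$, where $\eta$ may depend on $T$) the regret on the constructed sequence is at least $cT^{1/3}$. Hedge with learning rate $\eta$: in round $t\ge1$ it plays $p_t\in\Delta_d=\{p\in\mathbb R^d: p_i\ge0,\ \sum_ip_i=1\}$ with $p_{t,i}\propto\exp\!\big(-\eta\sum_{\tau=1}^{t-1}\ell_{\tau,i}\big)$; $p_{T+1}$ is defined by the same rule. Alternating regret: $\mathrm{Reg}_{\mathrm{Alt}}=\max_{u\in\Delta_d}\left\{\sum_{t=1}^T\langle p_t+p_{t+1},\ell_t\rangle-2\sum_{t=1}^T\langle u,\ell_t\rangle\right\}$. *)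

(* Defs.v *)
From mathcomp Require Import all_boot all_order all_algebra.
From mathcomp Require Import all_classical all_reals all_analysis.

Set Implicit Arguments.
Unset Strict Implicit.
Unset Printing Implicit Defensive.

Import Order.TTheory GRing.Theory Num.Theory.

Local Open Scope classical_set_scope.
Local Open Scope ring_scope.

Definition inner (R : realType) (d : nat) (x y : 'rV[R]_d) : R :=
  \sum_(i < d) x 0 i * y 0 i.

Definition simplex (R : realType) (d : nat) : set 'rV[R]_d :=
  [set p | (forall i, 0 <= p 0 i) /\ \sum_(i < d) p 0 i = 1].
Arguments simplex : clear implicits.

(* Rounds are numbered from 1: a sequence of T losses is given by the values
   at 1, ..., T of a function on nat, whose other values are never read. *)

Definition hedge_weight (R : realType) (d : nat) (eta : R)
    (ell : nat -> 'rV[R]_d) (t : nat) (i : 'I_d) : R :=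
  expR (- eta * \sum_(1 <= s < t) ell s 0 i).

Definition hedge (R : realType) (d : nat) (eta : R)
    (ell : nat -> 'rV[R]_d) (t : nat) : 'rV[R]_d :=
  \row_i (hedge_weight eta ell t i / \sum_(j < d) hedge_weight eta ell t j).

Definition alt_regret_against (R : realType) (d T : nat)
    (p ell : nat -> 'rV[R]_d) (u : 'rV[R]_d) : R :=
  \sum_(1 <= t < T.+1) inner (p t + p t.+1) (ell t)
  - 2 * \sum_(1 <= t < T.+1) inner u (ell t).

(* For d > 0 the supremum is a maximum, see [alt_regret_max] below. *)
Definition alt_regret (R : realType) (d T : nat)
    (p ell : nat -> 'rV[R]_d) : R :=
  sup [set alt_regret_against T p ell u | u in simplex R d].

Lemma alt_regret_max (R : realType) (d T : nat) (p ell : nat -> 'rV[R]_d) :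
  (0 < d)%N ->
  (exists2 u, simplex R d u & alt_regret T p ell = alt_regret_against T p ell u)
  /\ (forall u, simplex R d u ->
        alt_regret_against T p ell u <= alt_regret T p ell).
Proof.
case: d p ell => // d p ell _.
pose L i := \sum_(1 <= t < T.+1) ell t 0 i.
have LE u : \sum_(1 <= t < T.+1) inner u (ell t) = \sum_i u 0 i * L i.
  rewrite /inner exchange_big /=; apply: eq_bigr => i _.
  by rewrite mulr_sumr.
have [k kmin] : exists k, forall i, L k <= L i.
  case: (@arg_minP _ _ _ ord0 predT L isT) => k _ H.
  by exists k => i; apply: H.
pose e : 'rV[R]_d.+1 := delta_mx 0 k.
have eE i : e 0 i = (i == k)%:R by rewrite mxE eqxx.
have eS : simplex R d.+1 e.
  split=> [i|]; first by rewrite eE ler0n.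
  rewrite (bigD1 k) //= eE eqxx big1 ?addr0// => i /negbTE ik.
  by rewrite eE ik.
have Le : \sum_i e 0 i * L i = L k.
  rewrite (bigD1 k) //= eE eqxx mul1r big1 ?addr0// => i /negbTE ik.
  by rewrite eE ik mul0r.
have emax u : simplex R d.+1 u ->
    alt_regret_against T p ell u <= alt_regret_against T p ell e.
  move=> [u0 u1]; rewrite /alt_regret_against !LE Le lerD2l lerN2 ler_pM2l//.
  rewrite -[L k]mul1r -u1 mulr_suml; apply: ler_sum => i _.
  exact: ler_wpM2l.
pose A := [set alt_regret_against T p ell u | u in simplex R d.+1].
have ubA : ubound A (alt_regret_against T p ell e).
  by move=> _ [u uS <-]; apply: emax.
have supE : alt_regret T p ell = alt_regret_against T p ell e.
  apply/eqP; rewrite eq_le; apply/andP; split.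
    by apply: ge_sup => //; exists (alt_regret_against T p ell e), e.
  apply: ub_le_sup; last by exists e.
  by exists (alt_regret_against T p ell e).
by split; [exists e | move=> u uS; rewrite supE; apply: emax].
Qed.

(* Main.v *)
(** Let [z = T^(1/3)] and [x = exp (- eta)].

    If [eta <= 1 / (2 z)], charge loss 1 to every expert but one: the weights
    decay so slowly that a constant regret is paid in each of the first [z]
    rounds.

    If [eta > 1 / (2 z)], split the experts into three classes of sizes
    [m0, m1, m2] and charge loss 1 to the classes in turn.  Each cycle of three
    rounds adds the same amount to every cumulative loss, so Hedge returns to
    the uniform distribution, and the alternating regret of a cycle is exactly
    [m0 m1 m2 (1 - x)^2 / (w0 w1 w2)], where [w_r <= d] is the total weight
    before the [r]-th round of the cycle.  For balanced classes this is at
    least a constant times [min(1, eta)^2], and [T / 3] cycles give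
    [T / z^2 = z]. *)

Require Import Defs.
From mathcomp Require Import all_boot all_order all_algebra.
From mathcomp Require Import all_classical all_reals all_analysis.
From mathcomp Require Import zify ring lra.

Import Order.TTheory GRing.Theory Num.Theory.

Local Open Scope ring_scope.

(** * Regret against one expert, and general facts on Hedge *)

(** A vertex of the simplex is an admissible comparator, and with it the regret can be bounded below
    round by round. *)
Lemma alt_regret_ge_expert (R : realType) (d T : nat) (p ell : nat -> 'rV[R]_d)
    (k : 'I_d) :
  \sum_(1 <= t < T.+1) (inner (p t + p t.+1) (ell t) - 2 * ell t 0 k)
    <= alt_regret T p ell.
Proof.
have d0 : (0 < d)%N by case: k => m; apply: leq_ltn_trans.
have [_ /(_ (delta_mx 0 k))] := @alt_regret_max R d T p ell d0.
have dE i : (delta_mx 0 k : 'rV[R]_d) 0 i = (i == k)%:R by rewrite mxE eqxx.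
have dS : simplex R d (delta_mx 0 k).
  split=> [i|]; first by rewrite dE ler0n.
  rewrite (bigD1 k) //= dE eqxx big1 ?addr0// => i /negbTE ik.
  by rewrite dE ik.
move=> /(_ dS); apply: le_trans.
rewrite /alt_regret_against big_split sumrN -mulr_sumr /= lerB// ler_pM2l//.
apply: ler_sum => t _; rewrite /inner (bigD1 k) //= dE eqxx mul1r.
by rewrite big1 ?addr0// => i /negbTE ik; rewrite dE ik mul0r.
Qed.

Lemma innerDl (R : realType) (d : nat) (p q l : 'rV[R]_d) :
  inner (p + q) l = inner p l + inner q l.
Proof.
by rewrite /inner -big_split; apply: eq_bigr => i _; rewrite mxE mulrDl.
Qed.

(** Normalisation cancels a shift [a] common to all experts; this is what makes complete cycles
    invisible to Hedge. *)
Lemma hedgeE (R : realType) (d : nat) (eta : R) (ell : nat -> 'rV[R]_d)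
    (t : nat) (a : R) (v : 'I_d -> R) :
  (forall i, \sum_(1 <= s < t) ell s 0 i = a + v i) ->
  forall i, hedge eta ell t 0 i =
    expR (- eta * v i) / \sum_j expR (- eta * v j).
Proof.
move=> cumE i; rewrite mxE.
have wE j : hedge_weight eta ell t j = expR (- eta * a) * expR (- eta * v j).
  by rewrite /hedge_weight cumE mulrDr expRD.
rewrite wE (eq_bigr _ (fun j _ => wE j)) -mulr_sumr invfM mulrACA divff ?mul1r//.
by rewrite gt_eqF ?expR_gt0.
Qed.

Lemma hedge_ge0 (R : realType) (d : nat) (eta : R) (ell : nat -> 'rV[R]_d)
    (t : nat) (i : 'I_d) : 0 <= hedge eta ell t 0 i.
Proof. by rewrite mxE divr_ge0 ?expR_ge0// sumr_ge0// => j _; apply: expR_ge0. Qed.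

Lemma eq_hedge (R : realType) (d : nat) (eta : R) (ell ell' : nat -> 'rV[R]_d)
    (t : nat) :
  (forall s, (1 <= s < t)%N -> ell s = ell' s) ->
  hedge eta ell t = hedge eta ell' t.
Proof.
move=> eq_ell; have eq_w i : hedge_weight eta ell t i = hedge_weight eta ell' t i.
  by congr (expR (_ * _)); apply: eq_big_nat => s /eq_ell ->.
by apply/rowP => i; rewrite !mxE eq_w; congr (_ / _); apply: eq_bigr.
Qed.

(** * Small learning rates: one expert is spared *)

Definition all_but_one_loss (R : realType) (d : nat) (k : 'I_d) (t : nat) :
  'rV[R]_d := \row_i (i != k)%:R.

(** The [d - 1] charged experts have weight [e] each, out of a total [W <= d], and
    [(d - 1) / d >= 1 / 2]. *)
Lemma hedge_all_but_one (R : realType) (d : nat) (eta : R) (k : 'I_d) (t : nat) :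
  0 <= eta -> (1 < d)%N ->
  (1 - eta * t%:R) / 2 <=
    inner (hedge eta (all_but_one_loss R d k) t.+1) (all_but_one_loss R d k t.+1).
Proof.
move=> eta0 d1.
have cumE i : \sum_(1 <= s < t.+1) all_but_one_loss R d k s 0 i
    = 0 + t%:R * (i != k)%:R.
  rewrite add0r; under eq_bigr do rewrite mxE.
  by rewrite sumr_const_nat subn1 /= mulr_natl.
have d0 : 0 < d%:R :> R by rewrite ltr0n ltnW.
set W := \sum_j expR (- eta * (t%:R * (j != k)%:R)).
have W0 : 0 < W.
  by rewrite /W (bigD1 k) //= ltr_pwDl ?expR_gt0// sumr_ge0// => j _; rewrite expR_ge0.
have Wd : W <= d%:R.
  rewrite -[d in d%:R]card_ord -sumr_const; apply: ler_sum => j _.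
  by rewrite -expR0 ler_expR mulNr oppr_le0 !mulr_ge0.
set e := expR (- eta * t%:R).
have innerE : inner (hedge eta (all_but_one_loss R d k) t.+1)
    (all_but_one_loss R d k t.+1) = e / W * (d%:R - 1).
  have -> : d%:R - 1 = \sum_(i < d) (i != k)%:R :> R.
    rewrite (bigD1 k) //= eqxx add0r.
    rewrite (eq_bigr (fun=> 1)) => [|i ->//].
    rewrite sumr_const cardC1 card_ord -[in LHS](prednK (ltnW d1)).
    by rewrite -natr1 addrK.
  rewrite mulr_sumr; apply: eq_bigr => i _; rewrite (hedgeE _ _ _ _ _ _ _ cumE) mxE.
  by case: (i != k); rewrite ?mulr0// !mulr1.
rewrite innerE.
have e1 : 1 - eta * t%:R <= e by rewrite -mulNr expR_ge1Dx.
have e0 : 0 <= e by rewrite expR_ge0.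
apply: (@le_trans _ _ (e / 2)); first by rewrite ler_pM2r.
rewrite -mulrA ler_wpM2l// mulrC ler_pdivlMr//.
have : 2%:R <= d%:R :> R by rewrite ler_nat.
lra.
Qed.

(** Expert [k] never pays, so no round contributes negatively. In each of the first [n] rounds the
    play [p t] alone contributes [(1 - 1 / 2) / 2]. *)
Lemma alt_regret_all_but_one (R : realType) (d n T : nat) (eta : R) (k : 'I_d) :
  0 <= eta -> (1 < d)%N -> (n <= T)%N -> eta * n%:R <= 2^-1 ->
  n%:R / 4 <=
    alt_regret T (hedge eta (all_but_one_loss R d k)) (all_but_one_loss R d k).
Proof.
move=> eta0 d1 nT etan; apply: le_trans (alt_regret_ge_expert _ _ _ _ _ k).
set F := BIG_F.
have inner_ge0 s t : 0 <= inner (hedge eta (all_but_one_loss R d k) s)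
    (all_but_one_loss R d k t).
  by apply: sumr_ge0 => i _; rewrite mulr_ge0 ?hedge_ge0// mxE ler0n.
have FE t : F t = inner (hedge eta (all_but_one_loss R d k) t)
    (all_but_one_loss R d k t) + inner (hedge eta (all_but_one_loss R d k) t.+1)
    (all_but_one_loss R d k t).
  by rewrite /F innerDl mxE eqxx mulr0 subr0.
rewrite (@big_cat_nat _ _ _ n.+1) //= -[leLHS]addr0 lerD//; last first.
  by apply: sumr_ge0 => t _; rewrite FE addr_ge0.
rewrite mulr_natl -[n in X in X <= _]subn0 -sumr_const_nat big_add1 /=.
apply: ler_sum_nat => t /andP[_ tn]; rewrite FE -[leLHS]addr0 lerD//.
apply: le_trans (hedge_all_but_one _ _ _ _ _ eta0 d1).
have : eta * t%:R <= eta * n%:R by rewrite ler_wpM2l// ler_nat ltnW.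
lra.
Qed.

(** * Larger learning rates: cyclic losses *)

(** As rounds start at 1, the predecessor makes round [(j * 3 + r).+1] charge residue class [r]. *)
Definition cyclic_loss (R : realType) (d : nat) (t : nat) : 'rV[R]_d :=
  \row_i (i %% 3 == t.-1 %% 3)%N%:R.

Definition class_size (R : realType) (d r : nat) : R :=
  \sum_(i < d) (i %% 3 == r)%N%:R.

(* The total Hedge weight before round [r] (counted from 0) of a cycle, up to
   the factor accumulated in the previous cycles. *)
Definition cycle_weight (R : realType) (d : nat) (x : R) (r : nat) : R :=
  \sum_(i < d) x ^+ (i %% 3 < r)%N.

Lemma cycle_weightE (R : realType) (d : nat) (x : R) (r : nat) :
  cycle_weight R d x r = x ^+ (0 < r)%N * class_size R d 0
    + x ^+ (1 < r)%N * class_size R d 1 + x ^+ (2 < r)%N * class_size R d 2.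
Proof.
rewrite !mulr_sumr -!big_split; apply: eq_bigr => i _ /=.
have: (i %% 3 < 3)%N by rewrite ltn_mod.
by case: (i %% 3)%N => [|[|[|//]]] _ /=; rewrite !(mulr1, mulr0, addr0, add0r).
Qed.

(** Each complete block of three consecutive indices meets every residue once. *)
Lemma class_size_ge (R : realType) (d r : nat) :
  (r < 3)%N -> (d %/ 3)%N%:R <= class_size R d r.
Proof.
move=> r3; rewrite /class_size -(big_mkord xpredT (fun i => (i %% 3 == r)%N%:R)).
rewrite {2}(divn_eq d 3) (@big_cat_nat _ _ _ (d %/ 3 * 3)) ?leq_addr//=.
rewrite -[leLHS]addr0 lerD ?sumr_ge0//.
elim: (d %/ 3)%N => [|m IHm]; first by rewrite big_geq.
rewrite mulSn !addSn add0n 3?big_nat_recr //= -natr1 -!addrA lerD//.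
rewrite -[(m * 3).+2]addn2 -[(m * 3).+1]addn1 modnMl !modnMDl.
by case: r r3 {IHm} => [|[|[|//]]] _ /=; rewrite !(addr0, add0r).
Qed.

Lemma class_size_ge5 (R : realType) (d r : nat) :
  (3 <= d)%N -> (r < 3)%N -> d%:R / 5 <= class_size R d r.
Proof.
move=> d3 r3; apply: le_trans (class_size_ge _ _ _ r3).
(* The constant 5 comes from [d = 5], where [d %/ 3 = d / 5]. *)
by rewrite ler_pdivrMr// -natrM ler_nat; lia.
Qed.

Lemma sum_cyclic_loss (R : realType) (d j r : nat) (i : 'I_d) :
  (r < 3)%N ->
  \sum_(1 <= s < (j * 3 + r).+1) cyclic_loss R d s 0 i = j%:R + (i %% 3 < r)%N%:R.
Proof.
have i3 : (i %% 3 < 3)%N by rewrite ltn_mod.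
rewrite big_add1 /=; under eq_bigr do rewrite mxE /=.
have full : \sum_(0 <= s < j * 3) (i %% 3 == s %% 3)%N%:R = j%:R :> R.
  elim: j => [|j IHj]; first by rewrite big_geq.
  rewrite mulSn !addSn add0n 3?big_nat_recr //= IHj -natr1 -!addrA.
  rewrite -[(j * 3).+2]addn2 -[(j * 3).+1]addn1 modnMl !modnMDl; congr (_ + _).
  by case: (i %% 3)%N i3 => [|[|[|//]]] _ /=; rewrite !(addr0, add0r).
case: r => [|[|[|//]]] _; first by rewrite addn0 full addr0.
all: rewrite ?addn1 ?addn2 ?big_nat_recr//= full;
  rewrite -?[(j * 3).+1]addn1 modnMl ?modnMDl -?addrA; congr (_ + _);
  by case: (i %% 3)%N i3 => [|[|[|//]]] _ /=; rewrite ?(addr0, add0r).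
Qed.

(** Play and loss have separate indices because a loss is also paired with the next play, which may
    open the next cycle. *)
Lemma inner_hedge_cyclic (R : realType) (d : nat) (eta : R) (j j' r r' : nat) :
  (r < 3)%N -> (r' < 3)%N ->
  inner (hedge eta (cyclic_loss R d) (j * 3 + r).+1)
        (cyclic_loss R d (j' * 3 + r').+1)
  = expR (- eta) ^+ (r' < r)%N * class_size R d r'
    / cycle_weight R d (expR (- eta)) r.
Proof.
move=> r3 r'3; have expE b : expR (- eta * b%:R) = expR (- eta) ^+ b.
  by rewrite -expRM_natl mulrC.
rewrite mulrAC /class_size mulr_sumr; apply: eq_bigr => i _.
rewrite (hedgeE _ _ _ _ _ _ _ (fun i => sum_cyclic_loss R d j r i r3)) mxE /=.
rewrite modnMDl (modn_small r'3) expE.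
have -> : \sum_(j0 < d) expR (- eta * (j0 %% 3 < r)%N%:R)
    = cycle_weight R d (expR (- eta)) r by apply: eq_bigr => i' _; exact: expE.
by case: eqP => [->|_]; rewrite ?mulr1 ?mulr0.
Qed.

Lemma cycle_identity (R : realFieldType) (a b c x : R) :
  0 < a -> 0 < b -> 0 < c -> 0 <= x ->
  a / (a + b + c) + x * a / (x * a + b + c)
  + (b / (x * a + b + c) + x * b / (x * a + x * b + c))
  + (c / (x * a + x * b + c) + c / (a + b + c)) - 2
  = a * b * c * (1 - x) ^+ 2
    / ((a + b + c) * (x * a + b + c) * (x * a + x * b + c)).
Proof.
move=> a0 b0 c0 x0.
have xa : 0 <= x * a by rewrite mulr_ge0// ltW.
have xb : 0 <= x * b by rewrite mulr_ge0// ltW.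
by field; rewrite !gt_eqF//; lra.
Qed.

(** In [cycle_identity] each class size is at least [d / 5] and each denominator factor at most [d],
    whence [125 = 5 ^ 3]. *)
Lemma cycle_regret_ge (R : realType) (d j : nat) (eta : R) (k : 'I_d)
    (F := fun t => inner (hedge eta (cyclic_loss R d) t
      + hedge eta (cyclic_loss R d) t.+1) (cyclic_loss R d t)
      - 2 * cyclic_loss R d t 0 k) :
  0 < eta -> (3 <= d)%N ->
  (1 - expR (- eta)) ^+ 2 / 125
    <= F (j * 3).+1 + F (j * 3).+2 + F (j * 3).+3.
Proof.
move=> eta0 d3; set x := expR (- eta).
set a := class_size R d 0; set b := class_size R d 1; set c := class_size R d 2.
have x0 : 0 <= x by rewrite expR_ge0.
have x1 : x <= 1 by rewrite -expR0 ler_expR oppr_le0 ltW.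
have d0 : 0 < d%:R :> R by rewrite ltr0n; lia.
have ad : d%:R / 5 <= a by apply: class_size_ge5.
have bd : d%:R / 5 <= b by apply: class_size_ge5.
have cd : d%:R / 5 <= c by apply: class_size_ge5.
have d50 : 0 < d%:R / 5 :> R by rewrite divr_gt0.
have [a0 b0 c0] : [/\ 0 < a, 0 < b & 0 < c] by split; lra.
have abc : a + b + c = d%:R.
  rewrite -[a]mul1r -[b]mul1r -[c]mul1r -(cycle_weightE R d 1 0).
  by rewrite /cycle_weight -[RHS]mulr1 mulr_natl -[d in RHS]card_ord -sumr_const.
(* Any expert pays exactly once per cycle, so the choice of [k] is immaterial. *)
have lossk : cyclic_loss R d (j * 3).+1 0 k + cyclic_loss R d (j * 3).+2 0 k
    + cyclic_loss R d (j * 3).+3 0 k = 1.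
  rewrite !mxE /= -[(j * 3).+2]addn2 -[(j * 3).+1]addn1 modnMl !modnMDl.
  have: (k %% 3 < 3)%N by rewrite ltn_mod.
  by case: (k %% 3)%N => [|[|[|//]]] _ /=; rewrite !(addr0, add0r).
have -> : F (j * 3).+1 + F (j * 3).+2 + F (j * 3).+3
  = a / (a + b + c) + x * a / (x * a + b + c)
    + (b / (x * a + b + c) + x * b / (x * a + x * b + c))
    + (c / (x * a + x * b + c) + c / (a + b + c)) - 2.
  have I := inner_hedge_cyclic R d eta.
  have I0 := I j j 0%N 0%N isT isT; have I1 := I j j 1%N 0%N isT isT.
  have I2 := I j j 1%N 1%N isT isT; have I3 := I j j 2%N 1%N isT isT.
  (* The play after the third round is the uniform one opening cycle [j.+1]. *)
  have I4 := I j j 2%N 2%N isT isT; have I5 := I j.+1 j 0%N 2%N isT isT.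
  move: I0 I1 I2 I3 I4 I5.
  rewrite !cycle_weightE /= !addn0 !addn1 !addn2 mulSn !addSn add0n -/x -/a -/b -/c.
  rewrite !(expr0, expr1, mul1r) => I0 I1 I2 I3 I4 I5.
  rewrite /F !innerDl I0 I1 I2 I3 I4 I5 -[2 in RHS]mulr1 -lossk.
  ring.
rewrite cycle_identity// abc.
have xa : x * a <= a by rewrite ler_piMl// ltW.
have xb : x * b <= b by rewrite ler_piMl// ltW.
have xa0 : 0 <= x * a by rewrite mulr_ge0// ltW.
have xb0 : 0 <= x * b by rewrite mulr_ge0// ltW.
rewrite ler_pdivlMr; last by rewrite !mulr_gt0//; lra.
have denle : d%:R * (x * a + b + c) * (x * a + x * b + c) <= d%:R * d%:R * d%:R.
  by rewrite !ler_pM ?mulr_ge0//; lra.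
have numge : d%:R / 5 * (d%:R / 5) * (d%:R / 5) <= a * b * c.
  by rewrite !ler_pM ?mulr_ge0//; lra.
rewrite mulrAC -mulrA [leRHS]mulrC ler_wpM2l ?sqr_ge0//; lra.
Qed.

(* Rounds that do not complete a cycle get zero losses, hence no regret. *)
Definition truncated_cyclic_loss (R : realType) (d n t : nat) : 'rV[R]_d :=
  if (t <= n)%N then cyclic_loss R d t else 0.

Lemma alt_regret_truncated_cyclic (R : realType) (d T : nat) (eta : R) :
  0 < eta -> (3 <= d)%N ->
  (T %/ 3)%N%:R * ((1 - expR (- eta)) ^+ 2 / 125) <=
    alt_regret T (hedge eta (truncated_cyclic_loss R d (T %/ 3 * 3)))
      (truncated_cyclic_loss R d (T %/ 3 * 3)).
Proof.
move=> eta0 d3; have k : 'I_d by exists 0%N; lia.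
set n := (T %/ 3 * 3)%N; set ell := truncated_cyclic_loss R d n.
apply: le_trans (alt_regret_ge_expert _ _ _ _ _ k).
have nT : (n <= T)%N by rewrite leq_trunc_div.
have ellE t : (t <= n)%N -> ell t = cyclic_loss R d t.
  by rewrite /ell /truncated_cyclic_loss => ->.
(* A play reads only earlier losses, so agreement extends to play [n.+1], which round [n] needs. *)
have hE t : (t <= n)%N -> hedge eta ell t.+1 = hedge eta (cyclic_loss R d) t.+1.
  move=> tn; apply: eq_hedge => s /andP[_ st]; apply: ellE.
  exact: leq_trans tn.
rewrite (@big_cat_nat _ _ _ n.+1) //=.
rewrite [X in _ <= _ + X]big_nat_cond [X in _ <= _ + X]big1 ?addr0; last first.
  move=> t /andP[/andP[nt _] _].
  have -> : ell t = 0 by rewrite /ell /truncated_cyclic_loss leqNgt nt.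
  rewrite mxE mulr0 subr0 /inner big1 // => i _.
  by rewrite [X in _ * X]mxE mulr0.
rewrite big_add1 /=.
under eq_big_nat => t /andP[_ tn].
  rewrite ellE// hE ?(ltnW tn)// hE//.
  over.
clear ellE hE; rewrite {nT ell}/n; elim: (T %/ 3)%N => [|m IHm].
  by rewrite mul0r big_geq.
rewrite mulSn !addSn add0n 3?big_nat_recr //= -natr1 mulrDl mul1r -!addrA lerD//.
by have := cycle_regret_ge R d m eta k eta0 d3; rewrite /= !addrA.
Qed.

(** * Choice between the two regimes *)

Lemma one_sub_expRN_ge (R : realType) (y : R) :
  0 <= y -> y / (1 + y) <= 1 - expR (- y).
Proof.
move=> y0; have y1 : 0 < 1 + y by lra.
have : expR (- y) <= (1 + y)^-1.
  by rewrite expRN lef_pV2 ?posrE ?expR_gt0// expR_ge1Dx.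
have -> : y / (1 + y) = 1 - (1 + y)^-1 by field; rewrite gt_eqF.
lra.
Qed.

Theorem theorem18 (R : realType) :
  exists c : R, 0 < c /\
  exists T0 : nat, forall T : nat, (T0 <= T)%N ->
  forall (d : nat) (eta : R), (3 <= d)%N -> 0 < eta ->
  exists ell : nat -> 'rV[R]_d,
    (forall t : nat, (1 <= t <= T)%N ->
       forall i : 'I_d, 0 <= ell t 0 i <= 1) /\
    c * (T%:R `^ 3^-1) <= alt_regret T (hedge eta ell) ell.
Proof.
(* [36 = 4 * 9]: the 4 from [T %/ 3 >= T / 4], valid for [T >= 8], and the 9 from squaring
   [(3 * z)^-1]. *)
exists (36 * 125)^-1; split; first by rewrite invr_gt0 mulr_gt0 ?ltr0n.
exists 8%N => T T8 d eta d3 eta0.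
set z := T%:R `^ 3^-1.
have z0 : 0 <= z by rewrite powR_ge0.
have z3 : z ^+ 3 = T%:R.
  by rewrite /z -powR_mulrn ?powR_ge0// -powRrM mulVf ?powRr1.
have z1 : 1 <= z.
  rewrite leNgt; apply/negP => zlt1.
  have : T%:R < 1 :> R by rewrite -z3 exprn_ilt1.
  by rewrite ltrn1; lia.
have [etaz|etaz] := leP (eta * z) 2^-1.
  have k : 'I_d by exists 0%N; lia.
  exists (all_but_one_loss R d k); split=> [t _ i|].
    by rewrite mxE; case: (_ != _); rewrite ?ler01 ?lexx.
  have /andP[nz zn] := truncn_itv z0; set n := Num.truncn z in nz zn.
  have nT : (n <= T)%N.
    by rewrite -(ler_nat R) -z3 (le_trans nz)// ler_eXnr.
  have etan : eta * n%:R <= 2^-1 by apply: le_trans etaz; rewrite ler_pM2l.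
  apply: le_trans (alt_regret_all_but_one _ _ _ _ _ _ (ltW eta0) (ltnW d3) nT etan).
  (* Now [z < n + 1 <= 2 * n], so [n / 4] exceeds [z / 8]. *)
  have n1 : 1 <= n%:R :> R by rewrite ler1n truncn_gt0.
  move: zn; rewrite -natr1; lra.
exists (truncated_cyclic_loss R d (T %/ 3 * 3)); split=> [t _ i|].
  by rewrite /truncated_cyclic_loss; case: ifP => _; rewrite mxE ?lexx ?ler01//;
    case: (_ == _); rewrite ?ler01 ?lexx.
apply: le_trans (alt_regret_truncated_cyclic R d T eta eta0 d3).
have zgt0 : 0 < z by lra.
(* By monotonicity [eta] may be lowered to [(2 * z)^-1], which yields [(2 * z + 1)^-1]; then
   [z >= 1] is used. *)
have yge : (3 * z)^-1 <= 1 - expR (- eta).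
  have w0 : 0 <= (2 * z)^-1 by rewrite invr_ge0; lra.
  apply: (@le_trans _ _ (1 - expR (- (2 * z)^-1))).
    apply: le_trans (one_sub_expRN_ge R _ w0).
    have -> : (2 * z)^-1 / (1 + (2 * z)^-1) = (2 * z + 1)^-1.
      by field; rewrite !gt_eqF//; lra.
    by rewrite lef_pV2 ?posrE; lra.
  rewrite lerD2l lerN2 ler_expR lerN2 invfM.
  by rewrite ler_pdivrMr// ltW.
have sq : (3 * z)^-1 ^+ 2 <= (1 - expR (- eta)) ^+ 2.
  by rewrite lerXn2r// nnegrE ?(le_trans _ yge)// invr_ge0; lra.
have kT : z ^+ 3 / 4 <= (T %/ 3)%N%:R.
  by rewrite z3 ler_pdivrMr// -natrM ler_nat; lia.
apply: (@le_trans _ _ (z ^+ 3 / 4 * ((3 * z)^-1 ^+ 2 / 125))).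
  have -> : z ^+ 3 / 4 * ((3 * z)^-1 ^+ 2 / 125) = (36 * 125)^-1 * z.
    by field; rewrite gt_eqF.
  exact: lexx.
apply: ler_pM => //.
- by rewrite divr_ge0// exprn_ge0.
- by rewrite divr_ge0// sqr_ge0.
- by rewrite ler_pM2r.
Qed.
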